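(* For each integer $n\ge 0$ let $S_n(q)=\sum_{j=-n}^n (-1)^j q^{-j^2}$. Then for complex $a,c$ with $\max \{|a|, |c/q|, |ac/q|\}<1$, \begin{align*} \sum_{n=0}^\infty \frac{(q/c; q)_n}{(-a; q)_n} \biggl(-\frac{c}{q}\biggr)^n =\frac{(-q, a, c, -ac/q; q)_\infty}{(q, -a, -c/q, ac/q; q)_\infty}\Biggl(2+\sum_{n=1}^\infty (1+q^n)q^{n^2-2n}\frac{(q/a, q/c; q)_n (ac)^n}{(a, c; q)_n}\bigl(q^n S_n(q)-S_{n-1}(q)\bigr) \Biggr). \end{align*}
   Context: Throughout, $q$ is a complex number with $0<|q|<1$. For $x\in\mathbb{C}$, $(x;q)_\infty=\prod_{k=0}^\infty(1-xq^k)$ and, for an integer $n\ge 0$, $(x;q)_n=\prod_{k=0}^{n-1}(1-xq^k)$; also $(x_1,\dots,x_m;q)_n=(x_1;q)_n\cdots(x_m;q)_n$ for $n$ an integer or $\infty$. *)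

(* Defs.v *)
From Stdlib Require Import Reals.
From Coquelicot Require Import Coquelicot.
Open Scope C_scope.

Fixpoint qpoch (x q : C) (n : nat) : C :=
  match n with
  | O => 1
  | S m => qpoch x q m * (1 - x * Cpow q m)
  end.

(* infinite q-Pochhammer (x;q)_oo, the limit of (x;q)_n as n -> oo
   (the limit exists for |q| < 1) *)
Definition qpoch_inf (x q : C) : C :=
  lim (T := C_CompleteNormedModule) (filtermap (fun n => qpoch x q n) eventually).

Definition S_ (q : C) (n : nat) : C :=
  sum_n (G := C_AbelianMonoid)
    (fun k : nat =>
       let j := (Z.of_nat k - Z.of_nat n)%Z in
       Cpow (-1) (Z.abs_nat j) / Cpow q (Z.abs_nat j * Z.abs_nat j))
    (2 * n).

(* Main.v *)
(* The right-hand side is an instance of Bailey's lemma relative to 1. With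
   rho_1 = q/a, rho_2 = q/c it uses the Bailey pair
     alpha_0 = 2,  alpha_r = (1 + q^r) q^(r^2-r) (q^r S_r - S_(r-1)),
     beta_n = 2 (-1)^n / ((q;q)_n (-1;q)_n),
   so that it becomes a multiple of 2phi1(q/a, q/c; -1; q, -ac/q). Heine's second
   transformation carries this series to 2phi1(q, q/c; -a; q, -c/q), which is the
   left-hand side. The q-Gauss sum needed for Bailey's lemma is the case
   z = C/(AB) of the same transformation. *)

Require Import Defs.
From Stdlib Require Import Reals Lra Lia.
From Coquelicot Require Import Coquelicot.
Open Scope C_scope.

(** * Limits and series of complex numbers *)

(** The numbers S_n grow like q^(-n^2), so the analysis rests on the power q^(r^2-r) in alpha_r
    absorbing exactly this growth: alpha is bounded. With an upper bound on (x;q)_n, and a bound on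
    its inverse where it never vanishes, every double series that occurs has terms at most K r^n,
    and one criterion for exchanging sums serves throughout. The choice of rho_1, rho_2 is forced:
    relative to 1, Bailey's lemma has denominators (q/rho_1;q)_r = (a;q)_r and (q/rho_2;q)_r =
    (c;q)_r, and argument q/(rho_1 rho_2) = ac/q. The prefactor splits in the same way: (a, c)/(q,
    ac/q) comes from Bailey's lemma and (-q, -ac/q)/(-a, -c/q) from Heine, where the 2 in beta_n
    meets (-1;q)_oo = 2 (-q;q)_oo. *)

Fixpoint csum (u : nat -> C) (n : nat) : C :=
  match n with
  | O => 0
  | S m => csum u m + u m
  end.

Lemma csum_ext (u v : nat -> C) n :
  (forall k, (k < n)%nat -> u k = v k) -> csum u n = csum v n.
Proof.
induction n as [|n IH]; intros H; simpl; auto.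
rewrite IH, H; auto with arith.
Qed.

Lemma csum_plus (u v : nat -> C) n :
  csum (fun k => u k + v k) n = csum u n + csum v n.
Proof. induction n as [|n IH]; simpl; [|rewrite IH]; ring. Qed.

Lemma csum_scal (a : C) (u : nat -> C) n :
  csum (fun k => a * u k) n = a * csum u n.
Proof. induction n as [|n IH]; simpl; [|rewrite IH]; ring. Qed.

Lemma csum_S_l (u : nat -> C) n :
  csum u (S n) = u O + csum (fun k => u (S k)) n.
Proof.
induction n as [|n IH]; [simpl; ring|].
change (csum u (S (S n))) with (csum u (S n) + u (S n)).
rewrite IH; simpl; ring.
Qed.

Lemma csum_telescope (u : nat -> C) n :
  csum (fun k => u (S k) - u k) n = u n - u O.
Proof. induction n as [|n IH]; simpl; [|rewrite IH]; ring. Qed.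

Lemma csum_sum_n (u : nat -> C) n : sum_n u n = csum u (S n).
Proof.
induction n as [|n IH].
- rewrite sum_O; simpl; ring.
- rewrite sum_Sn, IH; reflexivity.
Qed.

(** Stated through the real sequence of distances, so that squeezing and limit rules over the reals
    apply; [clim_filterlim] links it to the filter notion. *)
Definition clim (u : nat -> C) (l : C) : Prop :=
  is_lim_seq (fun n => Cmod (u n - l)) 0.

Lemma clim_ext (u v : nat -> C) l :
  (forall n, u n = v n) -> clim u l -> clim v l.
Proof. intros H; apply is_lim_seq_ext; intros n; now rewrite H. Qed.

Lemma clim_le (u : nat -> C) (l : C) (e : nat -> R) :
  (forall n, (Cmod (u n - l) <= e n)%R) -> is_lim_seq e 0 -> clim u l.
Proof.
intros H He.
apply is_lim_seq_le_le with (fun _ => 0%R) e; auto using is_lim_seq_const.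
split; [apply Cmod_ge_0|apply H].
Qed.

Lemma clim_const (l : C) : clim (fun _ => l) l.
Proof.
apply clim_le with (fun _ => 0%R); [|apply is_lim_seq_const].
intros _; replace (l - l) with (RtoC 0) by ring; rewrite Cmod_0; lra.
Qed.

Lemma clim_plus (u v : nat -> C) (l m : C) :
  clim u l -> clim v m -> clim (fun n => u n + v n) (l + m).
Proof.
intros Hu Hv.
apply clim_le with (fun n => Cmod (u n - l) + Cmod (v n - m))%R.
- intros n; replace (u n + v n - (l + m)) with ((u n - l) + (v n - m)) by ring.
  apply Cmod_triangle.
- replace (Finite 0) with (Finite (0 + 0)) by (f_equal; ring).
  now apply is_lim_seq_plus'.
Qed.

Lemma clim_mult (u v : nat -> C) (l m : C) :
  clim u l -> clim v m -> clim (fun n => u n * v n) (l * m).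
Proof.
intros Hu Hv.
apply clim_le with (fun n => Cmod (u n - l) * Cmod (v n - m) +
   (Cmod l * Cmod (v n - m) + Cmod m * Cmod (u n - l)))%R.
- intros n.
  replace (u n * v n - l * m)
    with ((u n - l) * (v n - m) + (l * (v n - m) + m * (u n - l))) by ring.
  rewrite <- !Cmod_mult.
  eapply Rle_trans; [apply Cmod_triangle|].
  apply Rplus_le_compat_l, Cmod_triangle.
- replace (Finite 0) with (Finite (0 * 0 + (Cmod l * 0 + Cmod m * 0)))
    by (f_equal; ring).
  repeat apply is_lim_seq_plus'; repeat apply is_lim_seq_mult';
    auto using is_lim_seq_const.
Qed.

Lemma clim_scal (a : C) (u : nat -> C) (l : C) :
  clim u l -> clim (fun n => a * u n) (a * l).
Proof. apply clim_mult, clim_const. Qed.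

Lemma clim_unique (u : nat -> C) (l m : C) : clim u l -> clim u m -> l = m.
Proof.
intros Hl Hm.
assert (H : Rbar_le (Cmod (l - m)) (0 + 0)%R).
{ apply (is_lim_seq_le (fun _ => Cmod (l - m))
      (fun n => Cmod (u n - l) + Cmod (u n - m))%R (Cmod (l - m)) (0 + 0)%R).
  - intros n.
    replace (l - m) with (- (u n - l) + (u n - m)) by ring.
    rewrite <- (Cmod_opp (u n - l)); apply Cmod_triangle.
  - apply is_lim_seq_const.
  - now apply is_lim_seq_plus'. }
simpl in H.
replace l with ((l - m) + m) by ring.
rewrite (Cmod_eq_0 (l - m)); [ring|].
apply Rle_antisym; [lra|apply Cmod_ge_0].
Qed.


Lemma clim_Cmod (u : nat -> C) (l : C) :
  clim u l -> is_lim_seq (fun n => Cmod (u n)) (Cmod l).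
Proof.
intros H.
apply (is_lim_seq_le_le (fun n => Cmod l - Cmod (u n - l))%R _
         (fun n => Cmod l + Cmod (u n - l))%R).
- intros n; split.
  + enough (Cmod l <= Cmod (u n) + Cmod (u n - l))%R by lra.
    replace l with (u n + - (u n - l)) at 1 by ring.
    rewrite <- (Cmod_opp (u n - l)); apply Cmod_triangle.
  + replace (u n) with (l + (u n - l)) at 1 by ring.
    apply Cmod_triangle.
- replace (Finite (Cmod l)) with (Finite (Cmod l - 0)) by (f_equal; ring).
  apply is_lim_seq_minus'; auto using is_lim_seq_const.
- replace (Finite (Cmod l)) with (Finite (Cmod l + 0)) by (f_equal; ring).
  apply is_lim_seq_plus'; auto using is_lim_seq_const.
Qed.

Lemma clim_shift (u : nat -> C) (l : C) N :
  clim u l <-> clim (fun n => u (n + N)%nat) l.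
Proof. apply (is_lim_seq_incr_n (fun n => Cmod (u n - l)) N). Qed.

Lemma clim_filterlim (u : nat -> C) (l : C) :
  clim u l <-> filterlim u eventually (locally (T := C_NormedModule) l).
Proof.
rewrite (filterlim_locally_ball_norm (U := C_NormedModule)).
unfold clim; rewrite <- is_lim_seq_spec; unfold is_lim_seq', ball_norm.
assert (E : forall n, Rabs (Cmod (u n - l) - 0) = norm (minus (u n) l)).
{ intros n; rewrite Rminus_0_r, Rabs_pos_eq by apply Cmod_ge_0.
  reflexivity. }
split; intros H eps; specialize (H eps); revert H;
  apply filter_imp; intros n; now rewrite E.
Qed.

(** [lim] is a total function on filters, correct only for Cauchy ones. Convergence makes the filter
    Cauchy, and uniqueness of limits identifies the value. This is what gives [qpoch_inf] its
    meaning. *)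
Lemma clim_lim (u : nat -> C) (l : C) :
  clim u l -> lim (T := C_CompleteNormedModule) (filtermap u eventually) = l.
Proof.
intros H; apply clim_filterlim in H.
apply (filterlim_locally_unique (V := C_NormedModule) (F := eventually) u); auto.
apply filterlim_locally; intros eps.
apply (complete_cauchy (T := C_CompleteNormedModule) (filtermap u eventually)).
- apply filtermap_proper_filter, eventually_filter.
- intros e; exists l.
  now apply (proj1 (filterlim_locally (U := C_NormedModule) u l)).
Qed.

Definition sums (u : nat -> C) (s : C) : Prop := clim (csum u) s.

Lemma sums_is_series (u : nat -> C) (s : C) :
  sums u s <-> is_series (V := C_NormedModule) u s.
Proof.
unfold sums, is_series.
rewrite <- clim_filterlim, (clim_shift _ _ 1).
split; apply clim_ext; intros n; rewrite Nat.add_1_r; [symmetry|];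
  apply csum_sum_n.
Qed.

Lemma sums_ext (u v : nat -> C) s :
  (forall n, u n = v n) -> sums u s -> sums v s.
Proof. intros H; apply clim_ext; intros n; apply csum_ext; auto. Qed.

Lemma sums_unique (u : nat -> C) s t : sums u s -> sums u t -> s = t.
Proof. apply clim_unique. Qed.

Lemma sums_plus (u v : nat -> C) (s t : C) :
  sums u s -> sums v t -> sums (fun n => u n + v n) (s + t).
Proof.
intros Hs Ht; eapply clim_ext; [|apply (clim_plus _ _ _ _ Hs Ht)].
intros n; symmetry; apply csum_plus.
Qed.

Lemma sums_scal (a : C) (u : nat -> C) (s : C) :
  sums u s -> sums (fun n => a * u n) (a * s).
Proof.
intros Hs; eapply clim_ext; [|apply (clim_scal a _ _ Hs)].
intros n; symmetry; apply csum_scal.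
Qed.

Lemma sums_S (u : nat -> C) (s : C) :
  sums u s -> sums (fun n => u (S n)) (s - u O).
Proof.
intros Hs; apply (clim_shift _ _ 1) in Hs.
apply clim_ext with (fun n => csum u (n + 1) + - u O).
- intros n; rewrite Nat.add_1_r, csum_S_l; ring.
- apply clim_plus; auto using clim_const.
Qed.

Lemma sums_first (u : nat -> C) :
  (forall n, u (S n) = 0) -> sums u (u O).
Proof.
intros H; apply (clim_shift _ _ 1).
apply clim_ext with (fun _ => u O); [|apply clim_const].
intros n; rewrite Nat.add_1_r, csum_S_l.
rewrite (csum_ext _ (fun _ => 0 * 0)) by (intros; rewrite H; ring).
rewrite csum_scal; ring.
Qed.

Lemma sums_geom (u : nat -> C) (K r : R) :
  (0 <= r < 1)%R -> (forall n, (Cmod (u n) <= K * r ^ n)%R) ->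
  exists s, sums u s.
Proof.
intros Hr H.
destruct (ex_series_le (K := C_AbsRing) (V := C_CompleteNormedModule) u
  (fun n => K * r ^ n)%R) as [s Hs].
- exact H.
- apply (ex_series_scal (V := R_NormedModule) K), ex_series_geom.
  rewrite Rabs_pos_eq; lra.
- exists s; now apply sums_is_series.
Qed.

(** An explicit tail bound is needed because it is later used uniformly: over the columns of a
    double series, and over a family of power series. *)
Lemma sums_tail (u : nat -> C) (K r : R) (s : C) M :
  (0 <= r < 1)%R -> (forall n, (Cmod (u n) <= K * r ^ n)%R) -> sums u s ->
  (Cmod (s - csum u M) <= K * r ^ M / (1 - r))%R.
Proof.
intros Hr H Hs.
assert (HK : (0 <= K)%R).
{ generalize (H O) (Cmod_ge_0 (u O)); simpl; lra. }
assert (B : forall n, (Cmod (csum u (n + M) - csum u M)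
              <= K * (r ^ M - r ^ (n + M)) / (1 - r))%R).
{ induction n as [|n IH]; simpl.
  - replace (csum u M - csum u M) with (RtoC 0) by ring.
    rewrite Cmod_0; right; field; lra.
  - replace (csum u (n + M) + u (n + M)%nat - csum u M)
      with ((csum u (n + M) - csum u M) + u (n + M)%nat) by ring.
    eapply Rle_trans; [apply Cmod_triangle|].
    eapply Rle_trans; [apply Rplus_le_compat; [apply IH|apply H]|].
    right; field; lra. }
apply (clim_shift _ _ M) in Hs.
assert (L : clim (fun n => csum u (n + M) - csum u M) (s - csum u M)).
{ apply clim_plus with (v := fun _ => - csum u M); auto using clim_const. }
apply clim_Cmod in L.
change (Rbar_le (Cmod (s - csum u M)) (K * r ^ M / (1 - r))%R).
apply (is_lim_seq_le _ (fun _ => K * r ^ M / (1 - r))%R _ _) with (2 := L);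
  [|apply is_lim_seq_const].
intros n; eapply Rle_trans; [apply B|].
unfold Rdiv; apply Rmult_le_compat_r;
  [apply Rlt_le, Rinv_0_lt_compat; lra|].
apply Rmult_le_compat_l; auto.
enough (0 <= r ^ (n + M))%R by lra; apply pow_le; lra.
Qed.

(** With t = sqrt r, each of the n terms of 1 + t + ... + t^(n-1) is at least t^n, so n t^n is at
    most 1/(1-t); one factor t^n is left over to tend to 0. *)
Lemma is_lim_seq_n_geom (r : R) :
  (0 <= r < 1)%R -> is_lim_seq (fun n => INR n * r ^ n)%R 0.
Proof.
intros Hr.
set (t := sqrt r).
assert (Ht : (0 <= t < 1)%R).
{ split; [apply sqrt_pos|]; rewrite <- sqrt_1; apply sqrt_lt_1; lra. }
assert (B : forall n, (INR n * t ^ n <= (1 - t ^ n) / (1 - t))%R).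
{ induction n as [|n IH]; [simpl; right; field; lra|].
  assert (P : (0 <= t ^ n)%R) by (apply pow_le; lra).
  assert (Q : (t ^ n <= 1)%R) by (rewrite <- (pow1 n); apply pow_incr; lra).
  replace ((1 - t ^ S n) / (1 - t))%R with ((1 - t ^ n) / (1 - t) + t ^ n)%R
    by (simpl; field; lra).
  rewrite S_INR; simpl.
  assert (I : (0 <= INR n * t ^ n)%R) by (apply Rmult_le_pos; auto using pos_INR).
  apply Rle_trans with (INR n * t ^ n + t ^ n)%R; [nra|lra]. }
apply (is_lim_seq_le_le (fun _ => 0%R) _ (fun n => / (1 - t) * t ^ n)%R).
- intros n; split.
  + apply Rmult_le_pos; [apply pos_INR|apply pow_le; lra].
  + replace (r ^ n)%R with (t ^ n * t ^ n)%R.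
    * rewrite <- Rmult_assoc.
      assert (P : (0 <= t ^ n)%R) by (apply pow_le; lra).
      apply Rmult_le_compat_r; auto.
      eapply Rle_trans; [apply B|].
      unfold Rdiv; rewrite <- (Rmult_1_l (/ (1 - t))) at 2.
      apply Rmult_le_compat_r; [apply Rlt_le, Rinv_0_lt_compat; lra|lra].
    * rewrite <- Rpow_mult_distr; unfold t; now rewrite sqrt_sqrt.
- apply is_lim_seq_const.
- replace (Finite 0) with (Finite (/ (1 - t) * 0)) by (f_equal; ring).
  apply is_lim_seq_mult'; [apply is_lim_seq_const|].
  apply is_lim_seq_geom; rewrite Rabs_pos_eq; lra.
Qed.

Lemma Cmod_csum_le (u : nat -> C) (M : R) n :
  (forall k, (k < n)%nat -> (Cmod (u k) <= M)%R) ->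
  (Cmod (csum u n) <= INR n * M)%R.
Proof.
induction n as [|n IH]; intros H; [simpl; rewrite Cmod_0; lra|].
rewrite S_INR; simpl csum.
eapply Rle_trans; [apply Cmod_triangle|].
rewrite Rmult_plus_distr_r, Rmult_1_l.
apply Rplus_le_compat; auto.
Qed.

Lemma csum_triangle (f : nat -> nat -> C) N :
  csum (fun n => csum (f n) (S n)) N
  = csum (fun k => csum (fun m => f (k + m)%nat k) (N - k)) N.
Proof.
induction N as [|N IH]; [reflexivity|].
change (csum (fun n => csum (f n) (S n)) N + csum (f N) (S N)
  = csum (fun k => csum (fun m => f (k + m)%nat k) (S N - k)) N
    + csum (fun m => f (N + m)%nat N) (S N - N)).
replace (S N - N)%nat with 1%nat by lia.
change (csum (f N) (S N)) with (csum (f N) N + f N N).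
change (csum (fun m => f (N + m)%nat N) 1) with (0 + f (N + 0)%nat N).
rewrite IH, Nat.add_0_r.
rewrite (csum_ext (fun k => csum _ (S N - k))
  (fun k => csum (fun m => f (k + m)%nat k) (N - k) + f N k)).
- rewrite csum_plus; ring.
- intros k Hk.
  replace (S N - k)%nat with (S (N - k)) by lia; simpl.
  now replace (k + (N - k))%nat with N by lia.
Qed.

(* The common geometric bound [K r^n] makes the first [N] partial sums in the two
   orders differ by at most [N K r^N / (1 - r)]. *)
Lemma triangle_sums (f : nat -> nat -> C) (g : nat -> C) (K r : R) :
  (0 <= r < 1)%R ->
  (forall n k, (k <= n)%nat -> (Cmod (f n k) <= K * r ^ n)%R) ->
  (forall k, sums (fun m => f (k + m)%nat k) (g k)) ->
  exists s, sums (fun n => csum (f n) (S n)) s /\ sums g s.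
Proof.
intros Hr Hf Hg.
assert (Hf' : forall k m, (Cmod (f (k + m)%nat k) <= (K * r ^ k) * r ^ m)%R).
{ intros k m; rewrite Rmult_assoc, <- pow_add; apply Hf; lia. }
(* The bound depends on k + M only: cutting column k at M = N - k costs at most K r^N / (1 - r),
   whatever k is. The case M = 0 makes [g] summable. *)
assert (T : forall k M, (Cmod (g k - csum (fun m => f (k + m)%nat k) M)
                         <= K / (1 - r) * r ^ (k + M))%R).
{ intros k M.
  eapply Rle_trans;
    [apply (sums_tail _ _ r _ M Hr (Hf' k) (Hg k))|].
  right; rewrite pow_add; field; lra. }
destruct (sums_geom g (K / (1 - r)) r Hr) as [s Hs].
{ intros k; generalize (T k O); rewrite Nat.add_0_r; simpl.
  now replace (g k - 0) with (g k) by ring. }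
exists s; split; auto.
apply clim_ext with (fun N => csum g N
  + -1 * csum (fun k => g k - csum (fun m => f (k + m)%nat k) (N - k)) N).
{ intros N; rewrite csum_triangle.
  unfold Cminus at 1; rewrite csum_plus.
  rewrite (csum_ext (fun k => - csum _ _)
    (fun k => -1 * csum (fun m => f (k + m)%nat k) (N - k))) by (intros; ring).
  rewrite csum_scal; ring. }
replace s with (s + -1 * 0) by ring.
apply clim_plus; auto.
apply clim_scal.
apply clim_le with (fun N => K / (1 - r) * (INR N * r ^ N))%R.
- intros N.
  replace (csum (fun k => g k - csum (fun m => f (k + m)%nat k) (N - k)) N - 0)
    with (csum (fun k => g k - csum (fun m => f (k + m)%nat k) (N - k)) N) by ring.
  eapply Rle_trans; [apply Cmod_csum_le with (M := (K / (1 - r) * r ^ N)%R)|].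
  + intros k Hk; eapply Rle_trans; [apply T|].
    right; do 2 f_equal; lia.
  + right; ring.
- replace (Finite 0) with (Finite (K / (1 - r) * 0)) by (f_equal; ring).
  apply is_lim_seq_mult'; [apply is_lim_seq_const|now apply is_lim_seq_n_geom].
Qed.

(** * q-Pochhammer symbols and the q-binomial theorem *)

Lemma Cmod_sub_ge (x y : C) : (Cmod x - Cmod y <= Cmod (x - y))%R.
Proof.
enough (Cmod x <= Cmod (x - y) + Cmod y)%R by lra.
replace x with ((x - y) + y) at 1 by ring; apply Cmod_triangle.
Qed.

Lemma Cmod_sub_le (x y : C) : (Cmod (x - y) <= Cmod x + Cmod y)%R.
Proof. rewrite <- (Cmod_opp y); apply Cmod_triangle. Qed.

Lemma Cmult_neq0_inv (x y : C) : x * y <> 0 -> x <> 0 /\ y <> 0.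
Proof. intros H; split; intros E; apply H; rewrite E; ring. Qed.

Lemma Cdiv_neq0 (x y : C) : x <> 0 -> y <> 0 -> x / y <> 0.
Proof.
intros Hx Hy E; apply Hx.
replace x with (x / y * y) by (field; auto); rewrite E; ring.
Qed.

Lemma one_minus_neq0 (x : C) : (Cmod x < 1)%R -> 1 - x <> 0.
Proof.
intros H E; generalize (Cmod_sub_ge 1 x); rewrite E, Cmod_1, Cmod_0; lra.
Qed.

Lemma pow_le1 (x : R) n : (0 <= x <= 1)%R -> (0 <= x ^ n <= 1)%R.
Proof.
intros H; split; [apply pow_le; lra|].
rewrite <- (pow1 n); apply pow_incr; lra.
Qed.

Lemma Cmod_mul_pow_lt1 (x q : C) n :
  (Cmod x < 1)%R -> (Cmod q < 1)%R -> (Cmod (x * q ^ n) < 1)%R.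
Proof.
intros Hx Hq; rewrite Cmod_mult, Cmod_pow.
generalize (Cmod_ge_0 x) (pow_le1 (Cmod q) n); intros X Q.
destruct Q; [split; [apply Cmod_ge_0|lra]|]; nra.
Qed.

Lemma bounded_of_shift (u : nat -> R) (M : R) N :
  (forall n, (u (n + N)%nat <= M)%R) -> exists M', forall n, (u n <= M')%R.
Proof.
revert u; induction N as [|N IH]; intros u H.
- exists M; intros n; specialize (H n); now rewrite Nat.add_0_r in H.
- destruct (IH (fun n => u (S n))) as [M' HM'].
  + intros n; simpl; rewrite plus_n_Sm; apply H.
  + exists (Rmax (u O) M'); intros [|n]; [apply Rmax_l|].
    eapply Rle_trans; [apply HM'|apply Rmax_r].
Qed.

Lemma qpoch_S (x q : C) n :
  qpoch x q (S n) = qpoch x q n * (1 - x * q ^ n).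
Proof. reflexivity. Qed.

Lemma qpoch_add (x q : C) n m :
  qpoch x q (n + m) = qpoch x q n * qpoch (x * q ^ n) q m.
Proof.
induction m as [|m IH]; [rewrite Nat.add_0_r; simpl; ring|].
rewrite Nat.add_succ_r; simpl; rewrite IH, Cpow_add_r; ring.
Qed.

Lemma qpoch_S_l (x q : C) n :
  qpoch x q (S n) = (1 - x) * qpoch (x * q) q n.
Proof.
change (S n) with (1 + n)%nat; rewrite qpoch_add, Cpow_1_r; simpl; ring.
Qed.

Lemma qpoch_neq0_le (x q : C) n m :
  (m <= n)%nat -> qpoch x q n <> 0 -> qpoch x q m <> 0.
Proof.
intros H; replace n with (m + (n - m))%nat by lia; rewrite qpoch_add.
intros E; apply (Cmult_neq0_inv _ _ E).
Qed.

Lemma qpoch_neq0 (x q : C) n :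
  (Cmod x < 1)%R -> (Cmod q < 1)%R -> qpoch x q n <> 0.
Proof.
intros Hx Hq; induction n as [|n IH]; simpl.
- apply C1_nz.
- apply Cmult_neq_0; auto; now apply one_minus_neq0, Cmod_mul_pow_lt1.
Qed.

(** Each factor satisfies |1 - x q^k| <= 1 + |x| |q|^k <= exp(|x| |q|^k), and the exponents form a
    geometric series. *)
Lemma qpoch_bounded (x q : C) :
  (Cmod q < 1)%R -> exists M, forall n, (Cmod (qpoch x q n) <= M)%R.
Proof.
intros Hq.
set (r := Cmod q) in *; set (y := Cmod x).
assert (Hr : (0 <= r)%R) by apply Cmod_ge_0.
assert (Hy : (0 <= y)%R) by apply Cmod_ge_0.
assert (B : forall n,
  (Cmod (qpoch x q n) <= exp (y * ((1 - r ^ n) / (1 - r))))%R).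
{ induction n as [|n IH].
  - simpl; rewrite Cmod_1; right; rewrite <- exp_0 at 1; f_equal; field; lra.
  - replace (y * ((1 - r ^ S n) / (1 - r)))%R
      with (y * ((1 - r ^ n) / (1 - r)) + y * r ^ n)%R by (simpl; field; lra).
    rewrite exp_plus; rewrite qpoch_S; rewrite Cmod_mult.
    apply Rmult_le_compat; auto using Cmod_ge_0.
    eapply Rle_trans; [apply Cmod_sub_le|].
    rewrite Cmod_1, Cmod_mult, Cmod_pow; apply exp_ineq1_le. }
exists (exp (y * (1 / (1 - r)))); intros n.
eapply Rle_trans; [apply B|].
assert (L : (y * ((1 - r ^ n) / (1 - r)) <= y * (1 / (1 - r)))%R).
{ apply Rmult_le_compat_l; auto.
  apply Rmult_le_compat_r; [apply Rlt_le, Rinv_0_lt_compat; lra|].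
  generalize (pow_le r n Hr); lra. }
destruct L as [L|L]; [left; now apply exp_increasing|right; now rewrite L].
Qed.

(** A product of factors 1 - e_k is at least 1 minus the sum of the e_k. The threshold (1 - |q|)/2
    keeps the geometric sum of the |x| |q|^k below 1/2. *)
Lemma qpoch_ge_half (x q : C) n :
  (Cmod q < 1)%R -> (Cmod x <= (1 - Cmod q) / 2)%R ->
  (1 / 2 <= Cmod (qpoch x q n))%R.
Proof.
intros Hq Hx.
set (r := Cmod q) in *; set (y := Cmod x) in *.
assert (Hr : (0 <= r)%R) by apply Cmod_ge_0.
assert (Hy : (0 <= y)%R) by apply Cmod_ge_0.
assert (B : forall n, (1 - (1 - r ^ n) / 2 <= Cmod (qpoch x q n))%R).
{ induction n0 as [|m IH]; simpl; [rewrite Cmod_1; lra|].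
  rewrite Cmod_mult.
  assert (P := pow_le1 r m (conj Hr (Rlt_le _ _ Hq))).
  assert (Q : (1 - (1 - r) / 2 * r ^ m <= Cmod (1 - x * q ^ m))%R).
  { eapply Rle_trans; [|apply Cmod_sub_ge].
    rewrite Cmod_1, Cmod_mult, Cmod_pow; fold r y.
    generalize (Rmult_le_compat_r (r ^ m) _ _ (proj1 P) Hx); lra. }
  revert P Q IH; generalize (r ^ m)%R; intros p P Q IH.
  assert (P1 : (0 <= r * p)%R) by (apply Rmult_le_pos; lra).
  assert (P2 : (r * p <= p)%R) by nra.
  apply Rle_trans with ((1 - (1 - p) / 2) * (1 - (1 - r) / 2 * p))%R; [nra|].
  apply Rmult_le_compat; lra. }
eapply Rle_trans; [|apply B].
generalize (pow_le r n Hr); lra.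
Qed.

Lemma geom_eventually_le (M e r : R) :
  (0 <= r < 1)%R -> (0 < e)%R ->
  exists N, forall n, (N <= n)%nat -> (M * r ^ n <= e)%R.
Proof.
intros Hr He.
assert (L : is_lim_seq (fun n => M * r ^ n)%R (M * 0)%R).
{ apply is_lim_seq_mult'; [apply is_lim_seq_const|].
  apply is_lim_seq_geom; rewrite Rabs_pos_eq; lra. }
apply is_lim_seq_spec in L; destruct (L (mkposreal e He)) as [N HN].
exists N; intros n Hn; generalize (Rle_abs (M * r ^ n - M * 0)) (HN n Hn).
simpl; lra.
Qed.

(** After N factors the remaining product has parameter x q^N, small enough to stay above 1/2; the
    first N factors contribute a nonzero constant. *)
Lemma qpoch_inv_bounded (x q : C) :
  (Cmod q < 1)%R -> (forall n, qpoch x q n <> 0) ->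
  exists M, forall n, (Cmod (/ qpoch x q n) <= M)%R.
Proof.
intros Hq H.
destruct (geom_eventually_le (Cmod x) ((1 - Cmod q) / 2) (Cmod q)) as [N HN].
{ split; [apply Cmod_ge_0|lra]. }
{ lra. }
apply bounded_of_shift with (N := N) (M := (Cmod (/ qpoch x q N) * 2)%R).
intros n; rewrite Nat.add_comm, qpoch_add.
assert (B : (1 / 2 <= Cmod (qpoch (x * q ^ N) q n))%R).
{ apply qpoch_ge_half; auto; rewrite Cmod_mult, Cmod_pow; auto. }
assert (Z : qpoch (x * q ^ N) q n <> 0).
{ apply Cmod_gt_0; lra. }
replace (/ (qpoch x q N * qpoch (x * q ^ N) q n))
  with (/ qpoch x q N * / qpoch (x * q ^ N) q n) by (field; auto).
rewrite Cmod_mult; apply Rmult_le_compat_l; [apply Cmod_ge_0|].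
rewrite Cmod_inv by auto.
replace 2%R with (/ (1 / 2))%R by field.
apply Rinv_le_contravar; lra.
Qed.

(** Consecutive differences are -(x;q)_n x q^n, hence geometrically small; the limit is their sum
    plus (x;q)_0 = 1. *)
Lemma clim_qpoch (x q : C) :
  (Cmod q < 1)%R -> clim (qpoch x q) (qpoch_inf x q).
Proof.
intros Hq.
destruct (qpoch_bounded x q Hq) as [M HM].
assert (HM0 : (0 <= M)%R) by (eapply Rle_trans; [apply Cmod_ge_0|apply (HM O)]).
destruct (sums_geom (fun n => qpoch x q (S n) - qpoch x q n) (M * Cmod x) (Cmod q))
  as [s Hs].
- split; [apply Cmod_ge_0|auto].
- intros n; simpl.
  replace (qpoch x q n * (1 - x * q ^ n) - qpoch x q n)
    with (- (qpoch x q n * (x * q ^ n))) by ring.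
  rewrite Cmod_opp, !Cmod_mult, Cmod_pow, <- Rmult_assoc.
  apply Rmult_le_compat_r; [apply pow_le, Cmod_ge_0|].
  apply Rmult_le_compat_r; [apply Cmod_ge_0|auto].
- assert (L : clim (qpoch x q) (s + 1)).
  { apply clim_ext with (fun n =>
      csum (fun n => qpoch x q (S n) - qpoch x q n) n + 1).
    - intros n; rewrite csum_telescope; simpl; ring.
    - apply clim_plus; auto using clim_const. }
  unfold qpoch_inf.
  replace (lim (T := C_CompleteNormedModule) _) with (s + 1); auto.
  symmetry; now apply clim_lim.
Qed.

Lemma qpoch_inf_split (x q : C) n :
  (Cmod q < 1)%R -> qpoch_inf x q = qpoch x q n * qpoch_inf (x * q ^ n) q.
Proof.
intros Hq; apply (clim_unique (fun m => qpoch x q (m + n))).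
- apply (clim_shift (qpoch x q)); now apply clim_qpoch.
- apply clim_ext with (fun m => qpoch x q n * qpoch (x * q ^ n) q m).
  + intros m; now rewrite <- qpoch_add, Nat.add_comm.
  + apply clim_scal, clim_qpoch; auto.
Qed.

Lemma qpoch_inf_neq0 (x q : C) :
  (Cmod q < 1)%R -> (forall n, qpoch x q n <> 0) -> qpoch_inf x q <> 0.
Proof.
intros Hq H E.
destruct (qpoch_inv_bounded x q Hq H) as [M HM].
assert (L := clim_Cmod _ _ (clim_qpoch x q Hq)); rewrite E, Cmod_0 in L.
assert (B : is_lim_seq (fun n => M * Cmod (qpoch x q n))%R (M * 0)%R).
{ apply is_lim_seq_mult'; auto using is_lim_seq_const. }
assert (F : Rbar_le 1 (M * 0)%R).
{ apply (is_lim_seq_le (fun _ => 1%R) (fun n => M * Cmod (qpoch x q n))%R);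
    auto using is_lim_seq_const.
  intros n; rewrite <- Cmod_1.
  rewrite <- (Cinv_l (qpoch x q n)) by auto.
  rewrite Cmod_mult; apply Rmult_le_compat_r; auto using Cmod_ge_0. }
simpl in F; lra.
Qed.

(** For the series f this is the functional equation (1-z) f(z) = (1-az) f(qz), equivalent to f(z) -
    f(qz) = z (f(z) - a f(qz)). The latter holds coefficientwise, after dropping the constant term
    of f(z) - f(qz), which is zero. *)
Lemma qbinomial_step (a q z : C) (s t : C) :
  (Cmod q < 1)%R ->
  sums (fun n => qpoch a q n / qpoch q q n * z ^ n) s ->
  sums (fun n => qpoch a q n / qpoch q q n * (z * q) ^ n) t ->
  (1 - z) * s = (1 - a * z) * t.
Proof.
intros Hq Hs Ht.
assert (D := sums_S _ _ (sums_plus _ _ _ _ Hs (sums_scal (-1) _ _ Ht))).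
assert (E := sums_scal z _ _ (sums_plus _ _ _ _ Hs (sums_scal (- a) _ _ Ht))).
assert (U : s + -1 * t = z * (s + - a * t)).
{ apply (sums_unique (fun n => z * (qpoch a q n / qpoch q q n * z ^ n
    + - a * (qpoch a q n / qpoch q q n * (z * q) ^ n)))); auto.
  eapply sums_ext; [|replace (s + -1 * t) with
    (s + -1 * t - (qpoch a q 0 / qpoch q q 0 * z ^ 0
       + -1 * (qpoch a q 0 / qpoch q q 0 * (z * q) ^ 0)))
    by (simpl; field; apply C1_nz); exact D].
  intros n; cbv beta; rewrite !qpoch_S, !Cpow_mult_l, !Cpow_S; field.
  split; [now apply qpoch_neq0|].
  rewrite <- Cpow_S; apply one_minus_neq0.
  rewrite Cpow_S; now apply Cmod_mul_pow_lt1. }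
transitivity ((s + -1 * t) - z * s + t); [ring|rewrite U; ring].
Qed.

(** Iterating the functional equation gives (z;q)_n f(z) = (az;q)_n f(z q^n), and f(z q^n) tends to
    f(0) = 1. *)
Lemma qbinomial (a q z : C) :
  (Cmod q < 1)%R -> (Cmod z < 1)%R ->
  exists s, sums (fun n => qpoch a q n / qpoch q q n * z ^ n) s
    /\ qpoch_inf z q * s = qpoch_inf (a * z) q.
Proof.
intros Hq Hz.
destruct (qpoch_bounded a q Hq) as [M1 HM1].
destruct (qpoch_inv_bounded q q Hq) as [M2 HM2].
{ intros n; now apply qpoch_neq0. }
assert (B : forall w n, (Cmod (qpoch a q n / qpoch q q n * w ^ n)
                         <= M1 * M2 * Cmod w ^ n)%R).
{ intros w n; unfold Cdiv; rewrite !Cmod_mult, Cmod_pow.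
  apply Rmult_le_compat_r; [apply pow_le, Cmod_ge_0|].
  apply Rmult_le_compat; auto using Cmod_ge_0. }
assert (X : forall n, exists t,
  sums (fun m => qpoch a q m / qpoch q q m * (z * q ^ n) ^ m) t).
{ intros n; apply sums_geom with (2 := B (z * q ^ n)).
  split; [apply Cmod_ge_0|now apply Cmod_mul_pow_lt1]. }
destruct (X O) as [s Hs]; rewrite Cmult_1_r in Hs.
exists s; split; auto.
assert (I : forall n t,
  sums (fun m => qpoch a q m / qpoch q q m * (z * q ^ n) ^ m) t ->
  qpoch z q n * s = qpoch (a * z) q n * t).
{ induction n as [|n IH]; intros t Ht.
  - rewrite Cmult_1_r in Ht; simpl; rewrite (sums_unique _ _ _ Hs Ht); ring.
  - destruct (X n) as [t' Ht'].
    assert (E : (1 - z * q ^ n) * t' = (1 - a * (z * q ^ n)) * t).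
    { apply (qbinomial_step a q _ t' t Hq Ht').
      eapply sums_ext; [|apply Ht]; intros m; simpl.
      now replace (z * (q * q ^ n)) with (z * q ^ n * q) by ring. }
    rewrite !qpoch_S.
    transitivity (qpoch z q n * s * (1 - z * q ^ n)); [ring|].
    rewrite (IH t' Ht').
    transitivity (qpoch (a * z) q n * ((1 - z * q ^ n) * t')); [ring|].
    rewrite E; ring. }
apply (clim_unique (fun n => qpoch z q n * s)).
- apply clim_mult; auto using clim_const, clim_qpoch.
- set (d n := qpoch z q n * s - qpoch (a * z) q n).
  apply clim_ext with (fun n => d n + qpoch (a * z) q n).
  { intros n; unfold d; ring. }
  replace (qpoch_inf (a * z) q) with (0 + qpoch_inf (a * z) q) by ring.
  apply clim_plus; auto using clim_qpoch.
  destruct (qpoch_bounded (a * z) q Hq) as [M3 HM3].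
  apply clim_le
    with (fun n => M3 * (M1 * M2 * Cmod z / (1 - Cmod z)) * Cmod q ^ n)%R.
  + intros n; unfold d.
    destruct (X n) as [t Ht]; rewrite (I n t Ht).
    replace (qpoch (a * z) q n * t - qpoch (a * z) q n - 0)
      with (qpoch (a * z) q n * (t - 1)) by ring.
    rewrite Cmod_mult, Rmult_assoc.
    apply Rmult_le_compat; auto using Cmod_ge_0.
    assert (Hw : (0 <= Cmod (z * q ^ n) < 1)%R)
      by (split; [apply Cmod_ge_0|now apply Cmod_mul_pow_lt1]).
    (* Continuity of the series at 0: with the constant term 1 removed, the tail is of order |z
       q^n|. *)
    assert (T := sums_tail _ _ _ _ 1 Hw (B (z * q ^ n)) Ht).
    simpl in T; rewrite Rmult_1_r, Cmult_1_r, Cplus_0_l in T.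
    replace (RtoC 1 / 1) with (RtoC 1) in T by (field; apply C1_nz).
    eapply Rle_trans; [apply T|].
    rewrite Cmod_mult, Cmod_pow in *.
    assert (P : (Cmod q ^ n <= 1)%R)
      by (apply pow_le1; split; [apply Cmod_ge_0|lra]).
    assert (Z := Cmod_ge_0 z).
    assert (N : (0 <= M1 * M2)%R).
    { generalize (B 1 O); simpl; rewrite Rmult_1_r; intros B0.
      eapply Rle_trans; [apply Cmod_ge_0|apply B0]. }
    replace (M1 * M2 * Cmod z / (1 - Cmod z) * Cmod q ^ n)%R
      with (M1 * M2 * (Cmod z * Cmod q ^ n) * / (1 - Cmod z))%R by (field; lra).
    apply Rmult_le_compat_l; [apply Rmult_le_pos; lra|].
    apply Rinv_le_contravar; [lra|nra].
  + replace (Finite 0) with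
      (Finite (M3 * (M1 * M2 * Cmod z / (1 - Cmod z)) * 0)) by (f_equal; ring).
    apply is_lim_seq_mult'; [apply is_lim_seq_const|].
    apply is_lim_seq_geom; rewrite Rabs_pos_eq; auto using Cmod_ge_0.
Qed.

(** * Heine's second transformation and the q-Gauss sum *)

(** Truncated subtraction would yield 1/(q;q)_0 = 1 for k > n. The usual convention that 1/(q;q)_m
    is 0 for negative m keeps the recurrences valid at the boundary k = n. *)
Definition inv_qfact (q : C) (n k : nat) : C :=
  if Nat.leb k n then / qpoch q q (n - k) else 0.

Lemma inv_qfact_gt (q : C) n k : (n < k)%nat -> inv_qfact q n k = 0.
Proof. intros H; unfold inv_qfact; now rewrite (proj2 (Nat.leb_gt k n)). Qed.

Lemma inv_qfact_le (q : C) n k :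
  (k <= n)%nat -> inv_qfact q n k = / qpoch q q (n - k).
Proof. intros H; unfold inv_qfact; now rewrite (proj2 (Nat.leb_le k n)). Qed.

Lemma one_minus_pow_neq0 (q : C) n : (Cmod q < 1)%R -> 1 - q * q ^ n <> 0.
Proof. intros Hq; now apply one_minus_neq0, Cmod_mul_pow_lt1. Qed.

Lemma inv_qfact_S_r (q : C) n k :
  (Cmod q < 1)%R -> (k <= n)%nat ->
  inv_qfact q n (S k) = (1 - q ^ (n - k)) * inv_qfact q n k.
Proof.
intros Hq Hk; rewrite (inv_qfact_le q n k) by auto.
destruct (Nat.eq_dec k n) as [->|Hn].
- rewrite inv_qfact_gt, Nat.sub_diag by lia; simpl; ring.
- rewrite inv_qfact_le by lia.
  replace (n - k)%nat with (S (n - S k)) by lia.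
  rewrite qpoch_S, Cpow_S; field.
  split; [now apply one_minus_pow_neq0|now apply qpoch_neq0].
Qed.

(* [(-1)^k q^(k(k-1)/2) A^k (C/A;q)_k], written as a product so that it makes
   sense for [A = 0]. *)
Fixpoint jackson_coef (A C q : C) (k : nat) : Complex.C :=
  match k with
  | O => 1
  | S m => jackson_coef A C q m * - ((A - C * q ^ m) * q ^ m)
  end.

Lemma jackson_coef_S_l (A C q : C) k :
  jackson_coef A C q (S k) = - ((A - C) * q ^ k) * jackson_coef A (C * q) q k.
Proof.
induction k as [|k IH]; [simpl; ring|].
change (jackson_coef A C q (S (S k)))
  with (jackson_coef A C q (S k) * - ((A - C * q ^ S k) * q ^ S k)).
rewrite IH; simpl; ring.
Qed.

(** The m-th factor is at most (|A| + |C|) |q|^m, so from some index on the modulus no longer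
    increases. *)
Lemma jackson_coef_bounded (A C q : C) :
  (Cmod q < 1)%R -> exists M, forall k, (Cmod (jackson_coef A C q k) <= M)%R.
Proof.
intros Hq.
destruct (geom_eventually_le (Cmod A + Cmod C) 1 (Cmod q)) as [N HN].
{ split; [apply Cmod_ge_0|auto]. }
{ lra. }
apply bounded_of_shift with (N := N) (M := Cmod (jackson_coef A C q N)).
induction n as [|n IH]; simpl; [lra|].
rewrite Cmod_mult, Cmod_opp.
apply Rle_trans with (Cmod (jackson_coef A C q N) * 1)%R; [|lra].
apply Rmult_le_compat; auto using Cmod_ge_0.
eapply Rle_trans; [|apply (HN (n + N)%nat); lia].
rewrite Cmod_mult, Cmod_pow.
apply Rmult_le_compat_r; [apply pow_le, Cmod_ge_0|].
eapply Rle_trans; [apply Cmod_sub_le|apply Rplus_le_compat_l].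
rewrite Cmod_mult, Cmod_pow; apply Rle_trans with (Cmod C * 1)%R; [|lra].
apply Rmult_le_compat_l; [apply Cmod_ge_0|].
apply pow_le1; split; [apply Cmod_ge_0|lra].
Qed.

(** This is the sum of 2phi1(q^(-n), C/A; C; q, A q^n), divided by (q;q)_n and free of negative
    powers. The induction on n varies C, since the recurrence involves both C and Cq. *)
Lemma q_chu_vandermonde (A C q : C) n :
  (Cmod q < 1)%R -> (forall k, qpoch C q k <> 0) ->
  csum (fun k => jackson_coef A C q k / (qpoch q q k * qpoch C q k)
                 * inv_qfact q n k) (S n)
  = qpoch A q n / (qpoch q q n * qpoch C q n).
Proof.
intros Hq; revert C; induction n as [|n IH]; intros C HC.
{ simpl; unfold inv_qfact; simpl; field; apply C1_nz. }
assert (HC1 : 1 - C <> 0).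
{ generalize (HC 1%nat); simpl; now rewrite Cmult_1_l, Cmult_1_r. }
assert (HCq : forall k, qpoch (C * q) q k <> 0).
{ intros k; generalize (HC (S k)); rewrite qpoch_S_l; intros E.
  apply (Cmult_neq0_inv _ _ E). }
assert (Hqk : forall k, qpoch q q k <> 0) by (intros; now apply qpoch_neq0).
assert (R : (1 - q ^ S n)
    * csum (fun k => jackson_coef A C q k / (qpoch q q k * qpoch C q k)
                 * inv_qfact q (S n) k) (S (S n))
  = csum (fun k => jackson_coef A C q k / (qpoch q q k * qpoch C q k)
                 * inv_qfact q n k) (S n)
    + - (q ^ n * (A - C) / (1 - C))
      * csum (fun k => jackson_coef A (C * q) q k
             / (qpoch q q k * qpoch (C * q) q k) * inv_qfact q n k) (S n)).
{ rewrite <- !csum_scal.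
  (* Here 1 - q^(n+1) is split as (1 - q^(n+1-k)) + (1 - q^k) q^(n+1-k). The first part lowers n;
     the second kills k = 0 and, after shifting k, turns C into Cq. *)
  rewrite (csum_ext _ (fun k =>
    jackson_coef A C q k / (qpoch q q k * qpoch C q k) * inv_qfact q n k
    + jackson_coef A C q k / (qpoch q q k * qpoch C q k)
      * ((1 - q ^ k) * q ^ (S n - k) * inv_qfact q (S n) k)) (S (S n))).
  - rewrite csum_plus; f_equal.
    + change (csum ?u (S (S n))) with (csum u (S n) + u (S n)).
      cbv beta; rewrite (inv_qfact_gt q n (S n)) by lia; ring.
    + rewrite csum_S_l.
      replace (1 - q ^ 0) with (RtoC 0) by (simpl; ring).
      rewrite !Cmult_0_l, Cmult_0_r, Cplus_0_l.
      apply csum_ext; intros k Hk.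
      change (inv_qfact q (S n) (S k)) with (inv_qfact q n k).
      rewrite jackson_coef_S_l, (qpoch_S_l C), qpoch_S.
      replace (q ^ n) with (q ^ k * q ^ (n - k))
        by (rewrite <- Cpow_add_r; f_equal; lia).
      rewrite Cpow_S; simpl (S n - S k)%nat; field.
      repeat split; auto; now apply one_minus_pow_neq0.
  - intros k Hk.
    change (inv_qfact q n k) with (inv_qfact q (S n) (S k)).
    rewrite (inv_qfact_S_r q (S n) k) by (auto; lia).
    replace (q ^ S n) with (q ^ k * q ^ (S n - k))
      by (rewrite <- Cpow_add_r; f_equal; lia).
    ring. }
rewrite (IH C HC), (IH (C * q) HCq) in R.
assert (E : (1 - C) * qpoch (C * q) q n = qpoch C q n * (1 - C * q ^ n)).
{ rewrite <- qpoch_S_l; apply qpoch_S. }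
assert (HCn : 1 - C * q ^ n <> 0).
{ generalize (HC (S n)); rewrite qpoch_S; intros X.
  apply (Cmult_neq0_inv _ _ X). }
assert (Z : 1 - q ^ S n <> 0) by (rewrite Cpow_S; now apply one_minus_pow_neq0).
match goal with |- ?l = _ => set (X := l) in * end.
replace X with ((1 - q ^ S n) * X / (1 - q ^ S n)) by (field; auto).
rewrite R.
replace (qpoch (C * q) q n) with (qpoch C q n * (1 - C * q ^ n) / (1 - C))
  by (rewrite <- E; field; auto).
rewrite !qpoch_S, Cpow_S in *; field; auto 10.
Qed.

Definition phi21 (A B C q z : C) (n : nat) : Complex.C :=
  qpoch A q n * qpoch B q n / (qpoch q q n * qpoch C q n) * z ^ n.

(** Expand (A;q)_n / ((q;q)_n (C;q)_n) by q-Chu-Vandermonde and exchange sums: for fixed k the sum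
    over n = k + m is a q-binomial series with parameter B q^k, equal to (B z q^k;q)_oo / (z;q)_oo.
    Keeping (B z q^k;q)_oo inside the summand avoids dividing by (Bz;q)_k. *)
Lemma jackson_transformation (A B C q z : C) :
  (Cmod q < 1)%R -> (Cmod z < 1)%R -> (forall k, qpoch C q k <> 0) ->
  exists s, sums (phi21 A B C q z) s
    /\ sums (fun k => jackson_coef A C q k / (qpoch q q k * qpoch C q k)
                * (qpoch B q k * z ^ k) * qpoch_inf (B * z * q ^ k) q)
            (qpoch_inf z q * s).
Proof.
intros Hq Hz HC.
assert (Hqk : forall k, qpoch q q k <> 0) by (intros; now apply qpoch_neq0).
assert (Hzi : qpoch_inf z q <> 0).
{ apply qpoch_inf_neq0; auto; intros; now apply qpoch_neq0. }
destruct (qpoch_bounded B q Hq) as [M1 H1].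
destruct (jackson_coef_bounded A C q Hq) as [M2 H2].
destruct (qpoch_inv_bounded q q Hq Hqk) as [M3 H3].
destruct (qpoch_inv_bounded C q Hq HC) as [M4 H4].
destruct (triangle_sums
  (fun n k => jackson_coef A C q k / (qpoch q q k * qpoch C q k)
     * inv_qfact q n k * (qpoch B q n * z ^ n))
  (fun k => jackson_coef A C q k / (qpoch q q k * qpoch C q k)
     * (qpoch B q k * z ^ k) * (qpoch_inf (B * z * q ^ k) q / qpoch_inf z q))
  (M2 * (M3 * M4) * M3 * M1) (Cmod z)) as [s [Hs1 Hs2]].
- split; [apply Cmod_ge_0|auto].
- intros n k Hk; rewrite inv_qfact_le by auto.
  replace (jackson_coef A C q k / (qpoch q q k * qpoch C q k))
    with (jackson_coef A C q k * (/ qpoch q q k * / qpoch C q k))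
    by (field; auto).
  rewrite Cmult_assoc, !Cmod_mult, Cmod_pow.
  apply Rmult_le_compat_r; [apply pow_le, Cmod_ge_0|].
  repeat apply Rmult_le_compat; auto using Cmod_ge_0;
    repeat apply Rmult_le_pos; auto using Cmod_ge_0.
- intros k.
  destruct (qbinomial (B * q ^ k) q z Hq Hz) as [t [Ht Et]].
  replace (qpoch_inf (B * z * q ^ k) q) with (qpoch_inf z q * t)
    by (rewrite Et; f_equal; ring).
  replace (qpoch_inf z q * t / qpoch_inf z q) with t by (field; auto).
  eapply sums_ext; [|apply (sums_scal _ _ _ Ht)].
  intros m; cbv beta; rewrite inv_qfact_le, qpoch_add, Cpow_add_r by lia.
  replace (k + m - k)%nat with m by lia.
  field; auto.
- exists s; split.
  + eapply sums_ext; [|apply Hs1].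
    intros n; unfold phi21.
    rewrite (csum_ext _ (fun k => qpoch B q n * z ^ n
      * (jackson_coef A C q k / (qpoch q q k * qpoch C q k)
         * inv_qfact q n k))) by (intros; ring).
    rewrite csum_scal, q_chu_vandermonde by auto; field; auto.
  + eapply sums_ext; [|apply (sums_scal (qpoch_inf z q) _ _ Hs2)].
    intros k; cbv beta; field; auto.
Qed.

(* Jackson's transformation turns both sides into the same 2phi2 series, which
   avoids the analytic continuation needed when iterating Heine's first
   transformation. *)
Lemma heine_second (A B C q z : C) :
  (Cmod q < 1)%R -> (Cmod z < 1)%R -> (Cmod (C / B) < 1)%R ->
  B <> 0 -> C <> 0 ->
  (forall k, qpoch C q k <> 0) -> (forall k, qpoch (B * z) q k <> 0) ->
  exists s t, sums (phi21 A B C q z) s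
    /\ sums (phi21 (A * B * z / C) B (B * z) q (C / B)) t
    /\ qpoch_inf C q * qpoch_inf z q * s
       = qpoch_inf (C / B) q * qpoch_inf (B * z) q * t.
Proof.
intros Hq Hz HCB HB HC0 HC HBz.
assert (Hqk : forall k, qpoch q q k <> 0) by (intros; now apply qpoch_neq0).
destruct (jackson_transformation A B C q z Hq Hz HC) as [s [Hs Es]].
destruct (jackson_transformation (A * B * z / C) B (B * z) q (C / B) Hq HCB HBz)
  as [t [Ht Et]].
exists s, t; split; [exact Hs|split; [exact Ht|]].
apply sums_scal with (a := qpoch_inf C q) in Es.
apply sums_scal with (a := qpoch_inf (B * z) q) in Et.
rewrite <- Cmult_assoc, (Cmult_comm (qpoch_inf (C / B) q)), <- Cmult_assoc.
refine (sums_unique _ _ _ Es _).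
eapply sums_ext; [|exact Et].
intros k; cbv beta.
(* [jackson_coef] is homogeneous of degree k in its first two arguments: scaling (ABz/C, Bz) by C/B
   gives (Az, Cz), which is (A, C) scaled by z. *)
assert (P : jackson_coef (A * B * z / C) (B * z) q k * (C / B) ^ k
            = jackson_coef A C q k * z ^ k).
{ clear - HB HC0; induction k as [|k IH]; [reflexivity|].
  simpl jackson_coef; rewrite !Cpow_S.
  transitivity (jackson_coef (A * B * z / C) (B * z) q k * (C / B) ^ k
    * - ((A * z - C * z * q ^ k) * q ^ k)); [field; auto|rewrite IH; ring]. }
(* Cancelling (C;q)_k on one side and (Bz;q)_k on the other leaves both tails (C q^k;q)_oo and (B z
   q^k;q)_oo in each summand, so the two series agree term by term. *)
rewrite (qpoch_inf_split (B * z) q k Hq), (qpoch_inf_split C q k Hq).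
replace (B * (C / B)) with C by (field; auto).
transitivity (jackson_coef (A * B * z / C) (B * z) q k * (C / B) ^ k
  / qpoch q q k * qpoch B q k * qpoch_inf (B * z * q ^ k) q
  * qpoch_inf (C * q ^ k) q); [field; auto|rewrite P; field; auto].
Qed.

Lemma qpoch_1 (q : C) n : qpoch 1 q (S n) = 0.
Proof. rewrite qpoch_S_l; ring. Qed.

(** At this argument the transformed series has first parameter ABz/C = 1, and (1;q)_n = 0 for n >=
    1 reduces it to its leading term 1. *)
Lemma q_gauss (A B C q : C) :
  (Cmod q < 1)%R -> (Cmod (C / (A * B)) < 1)%R ->
  (Cmod (C / A) < 1)%R -> (Cmod (C / B) < 1)%R ->
  A <> 0 -> B <> 0 -> C <> 0 -> (forall k, qpoch C q k <> 0) ->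
  sums (phi21 A B C q (C / (A * B)))
    (qpoch_inf (C / A) q * qpoch_inf (C / B) q
     / (qpoch_inf C q * qpoch_inf (C / (A * B)) q)).
Proof.
intros Hq Hz HCA HCB HA HB HC0 HC.
assert (E : B * (C / (A * B)) = C / A) by (field; auto).
destruct (heine_second A B C q (C / (A * B)) Hq Hz HCB HB HC0 HC)
  as [s [t [Hs [Ht Est]]]].
{ rewrite E; intros k; now apply qpoch_neq0. }
rewrite E in *.
replace (A * B * (C / (A * B)) / C) with (RtoC 1) in Ht by (field; auto).
assert (Et : t = 1).
{ transitivity (phi21 1 B (C / A) q (C / B) 0);
    [|unfold phi21; simpl; field; apply C1_nz].
  apply (sums_unique _ _ _ Ht).
  apply sums_first; intros n; unfold phi21, Cdiv; rewrite qpoch_1; ring. }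
replace (_ * _ / (_ * _)) with s; [exact Hs|].
rewrite Et, Cmult_1_r, (Cmult_comm (qpoch_inf (C / B) q)) in Est.
rewrite <- Est; field; split; apply qpoch_inf_neq0; auto.
intros; now apply qpoch_neq0.
Qed.

(** * The Bailey pair *)

Lemma S_0 (q : C) : S_ q 0 = 1.
Proof. unfold S_; simpl; rewrite sum_O; simpl; field; apply C1_nz. Qed.

Lemma S_S (q : C) n :
  S_ q (S n) = S_ q n + 2 * ((-1) ^ S n / q ^ (S n * S n)).
Proof.
unfold S_; rewrite !csum_sum_n.
replace (2 * S n)%nat with (S (S (2 * n))) by lia.
rewrite csum_S_l.
match goal with |- _ + csum ?u (S (S (2 * n))) = csum ?v _ + ?t =>
  change (csum u (S (S (2 * n)))) with (csum u (S (2 * n)) + u (S (2 * n)));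
  rewrite (csum_ext u v) end.
- cbv zeta.
  replace (Z.abs_nat (Z.of_nat 0 - Z.of_nat (S n))) with (S n) by lia.
  replace (Z.abs_nat (Z.of_nat (S (S (2 * n))) - Z.of_nat (S n)))
    with (S n) by lia.
  ring.
- intros k _; cbv zeta.
  now replace (Z.of_nat (S k) - Z.of_nat (S n))%Z
    with (Z.of_nat k - Z.of_nat n)%Z by lia.
Qed.

(** The factor q^(n^2) cancels the dominant terms j = n and j = -n of S_n, giving a bounded sequence
    whose recurrence has no negative powers of q. *)
Definition scaled_S (q : C) (n : nat) : C := q ^ (n * n) * S_ q n.

Lemma scaled_S_S (q : C) n : q <> 0 ->
  scaled_S q (S n) = q ^ S (n + n) * scaled_S q n + 2 * (-1) ^ S n.
Proof.
intros Hq; unfold scaled_S; rewrite S_S.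
replace (q ^ (S n * S n)) with (q ^ S (n + n) * q ^ (n * n))
  by (rewrite <- Cpow_add_r; f_equal; lia).
field; split; now apply Cpow_nz.
Qed.

Lemma Cmod_m1_pow n : Cmod ((-1) ^ n) = 1%R.
Proof. rewrite Cmod_pow, Cmod_R, Rabs_left by lra.
replace (- -1)%R with 1%R by ring; apply pow1. Qed.

Lemma scaled_S_bounded (q : C) n : q <> 0 -> (Cmod q < 1)%R ->
  (Cmod (scaled_S q n) <= 2 / (1 - Cmod q))%R.
Proof.
intros Hq0 Hq; set (r := Cmod q) in *.
assert (Hr : (0 <= r)%R) by apply Cmod_ge_0.
(* The fixed point of b = r b + 2, which the recurrence preserves because |q^(2n+1)| <= r. *)
set (b := (2 / (1 - r))%R).
assert (Hb : (r * b + 2 = b)%R) by (unfold b; field; lra).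
assert (Hb2 : (2 <= b)%R) by nra.
induction n as [|n IH].
- unfold scaled_S; rewrite S_0; simpl; rewrite Cmult_1_r, Cmod_1; lra.
- rewrite scaled_S_S by auto.
  eapply Rle_trans; [apply Cmod_triangle|].
  rewrite !Cmod_mult, Cmod_m1_pow, Cmod_pow, Cmod_R, Rabs_pos_eq, Rmult_1_r
    by lra.
  rewrite <- Hb at 1; apply Rplus_le_compat_r.
  apply Rmult_le_compat; auto using Cmod_ge_0; [apply pow_le, Cmod_ge_0|].
  simpl; fold r; generalize (pow_le1 r (n + n)); nra.
Qed.

Definition bailey_alpha (q : C) (r : nat) : C :=
  match r with
  | O => 2
  | S m => (1 + q ^ S m) * (q ^ (S m * S m) / q ^ S m)
           * (q ^ S m * S_ q (S m) - S_ q m)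
  end.

Lemma bailey_alpha_S (q : C) m : q <> 0 ->
  bailey_alpha q (S m)
  = (1 + q ^ S m) * (scaled_S q (S m) - q ^ m * scaled_S q m).
Proof.
intros Hq; unfold bailey_alpha, scaled_S.
rewrite <- Cmult_assoc; f_equal.
replace (q ^ (S m * S m)) with (q ^ S m * (q ^ m * q ^ (m * m)))
  by (rewrite <- !Cpow_add_r; f_equal; lia).
field; now apply Cpow_nz.
Qed.

Lemma bailey_alpha_bounded (q : C) : q <> 0 -> (Cmod q < 1)%R ->
  exists M, forall r, (Cmod (bailey_alpha q r) <= M)%R.
Proof.
intros Hq0 Hq.
set (b := (2 / (1 - Cmod q))%R).
assert (P : forall n, (0 <= Cmod q ^ n <= 1)%R).
{ intros n; apply pow_le1; split; [apply Cmod_ge_0|lra]. }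
exists (Rmax 2 (2 * (b + 1 * b))); intros [|m].
- simpl; rewrite Cmod_R, Rabs_pos_eq by lra; apply Rmax_l.
- eapply Rle_trans; [|apply Rmax_r].
  rewrite bailey_alpha_S, Cmod_mult by auto.
  apply Rmult_le_compat; auto using Cmod_ge_0.
  + eapply Rle_trans; [apply Cmod_triangle|].
    rewrite Cmod_1, Cmod_pow; generalize (P (S m)); lra.
  + eapply Rle_trans; [apply Cmod_sub_le|].
    rewrite Cmod_mult, Cmod_pow.
    apply Rplus_le_compat; [now apply scaled_S_bounded|].
    apply Rmult_le_compat; auto using Cmod_ge_0; try apply P.
    now apply scaled_S_bounded.
Qed.

(** The coefficient of alpha_r in beta_n for a Bailey pair relative to 1. *)
Definition bailey_kernel (q : C) (n r : nat) : C :=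
  inv_qfact q n r / qpoch q q (n + r).

(** Folding j with -j, this is Gauss's alternating sum of the q-binomial coefficients [2n, n+j],
    divided by (q;q)_(2n). It follows from the recurrence (1 - q^(2n+2)) X_(n+1) = -X_n, proved by
    telescoping. *)
Lemma alternating_qbinomial_sum (q : C) n : (Cmod q < 1)%R ->
  bailey_kernel q n 0
    + 2 * csum (fun m => (-1) ^ S m * bailey_kernel q n (S m)) n
  = (-1) ^ n / (qpoch q q n * qpoch (- q) q n).
Proof.
intros Hq.
assert (Hqk : forall k, qpoch q q k <> 0) by (intros; now apply qpoch_neq0).
assert (Hmq : (Cmod (- q) < 1)%R) by now rewrite Cmod_opp.
assert (Hmk : forall k, qpoch (- q) q k <> 0) by (intros; now apply qpoch_neq0).
induction n as [|n IH].
{ unfold bailey_kernel, inv_qfact; simpl; field; apply C1_nz. }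
assert (Z : forall k, 1 - q * q ^ k <> 0)
  by (intros; now apply one_minus_pow_neq0).
assert (Z2 : 1 + q * q ^ n <> 0).
{ replace (1 + q * q ^ n) with (1 - (- q) * q ^ n) by ring.
  now apply one_minus_neq0, Cmod_mul_pow_lt1. }
(* Telescoping certificate for the recurrence: W_m = (-1)^m / ((q;q)_(n-m) (q;q)_(n+1+m)). The sum
   over positive j gives -W_0, and its double cancels the 2 W_0 of the term j = 0. *)
set (W m := (-1) ^ m * inv_qfact q (S n) (S m) / qpoch q q (S n + m)).
assert (T : forall m, (m < S n)%nat ->
  (1 - q ^ S n * q ^ S n) * ((-1) ^ S m * bailey_kernel q (S n) (S m))
  + (-1) ^ S m * bailey_kernel q n (S m) = W (S m) - W m).
{ intros m Hm; unfold W, bailey_kernel.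
  change (inv_qfact q n (S m)) with (inv_qfact q (S n) (S (S m))).
  rewrite (inv_qfact_S_r q (S n) (S m)) by (auto; lia).
  replace (n + S m)%nat with (S n + m)%nat by lia.
  replace (S n + S m)%nat with (S (S n + m)) by lia.
  rewrite qpoch_S, (Cpow_add_r q (S n) m).
  replace (q ^ S n) with (q ^ S m * q ^ (S n - S m))
    by (rewrite <- Cpow_add_r; f_equal; lia).
  rewrite !Cpow_S; field; split; auto.
  replace (q * (q * q ^ m * q ^ (S n - S m) * q ^ m))
    with (q * q ^ (S m + (S n - S m) + m)) by (rewrite !Cpow_add_r, Cpow_S; ring).
  auto. }
assert (T0 : (1 - q ^ S n * q ^ S n) * bailey_kernel q (S n) 0
             + bailey_kernel q n 0 = 2 * W O).
{ unfold W, bailey_kernel.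
  rewrite (inv_qfact_S_r q (S n) 0), !inv_qfact_le, !Nat.add_0_r, !Nat.sub_0_r
    by (auto; lia).
  rewrite qpoch_S, !Cpow_S; simpl ((-1) ^ 0); field; auto. }
assert (TS : (1 - q ^ S n * q ^ S n)
   * csum (fun m => (-1) ^ S m * bailey_kernel q (S n) (S m)) (S n)
   + csum (fun m => (-1) ^ S m * bailey_kernel q n (S m)) n = - W O).
{ transitivity (csum (fun m => W (S m) - W m) (S n)).
  - rewrite <- (csum_ext _ _ _ T), csum_plus, csum_scal; f_equal.
    change (csum ?u (S n)) with (csum u n + u n); cbv beta.
    unfold bailey_kernel at 3; rewrite inv_qfact_gt by lia.
    unfold Cdiv; ring.
  - rewrite csum_telescope; unfold W at 1.
    rewrite inv_qfact_gt by lia; unfold Cdiv; ring. }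
match goal with |- ?l = _ => set (X := l) end.
assert (E : (1 - q ^ S n * q ^ S n) * X
            = - ((-1) ^ n / (qpoch q q n * qpoch (- q) q n))).
{ rewrite <- IH; unfold X.
  transitivity (((1 - q ^ S n * q ^ S n) * bailey_kernel q (S n) 0
     + bailey_kernel q n 0)
    + 2 * ((1 - q ^ S n * q ^ S n)
       * csum (fun m => (-1) ^ S m * bailey_kernel q (S n) (S m)) (S n)
      + csum (fun m => (-1) ^ S m * bailey_kernel q n (S m)) n)
    - (bailey_kernel q n 0
      + 2 * csum (fun m => (-1) ^ S m * bailey_kernel q n (S m)) n)); [ring|].
  rewrite T0, TS; ring. }
replace (1 - q ^ S n * q ^ S n) with ((1 - q * q ^ n) * (1 + q * q ^ n)) in E
  by (rewrite Cpow_S; ring).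
replace X with (((1 - q * q ^ n) * (1 + q * q ^ n)) * X
   / ((1 - q * q ^ n) * (1 + q * q ^ n))) by (field; auto).
rewrite E, !qpoch_S, Cpow_S; field; repeat split; auto.
replace (1 - - q * q ^ n) with (1 + q * q ^ n) by ring; auto.
Qed.

Lemma qpoch_m1_S (q : C) n : qpoch (-1) q (S n) = 2 * qpoch (- q) q n.
Proof.
rewrite qpoch_S_l; replace (-1 * q) with (- q) by ring; ring.
Qed.

Lemma qpoch_m1_neq0 (q : C) n : (Cmod q < 1)%R -> qpoch (-1) q n <> 0.
Proof.
intros Hq; apply qpoch_neq0_le with (S n); [lia|].
rewrite qpoch_m1_S; apply Cmult_neq_0.
- intros E; apply RtoC_inj in E; lra.
- apply qpoch_neq0; auto; now rewrite Cmod_opp.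
Qed.

(* Abel summation against
   [F m = q^(m^2+m) S_m / ((q;q)_(n-m-1) (q;q)_(n+m))]
   leaves only the alternating sum of the Bailey kernel. *)
Lemma bailey_pair (q : C) n : q <> 0 -> (Cmod q < 1)%R ->
  csum (fun r => bailey_alpha q r * bailey_kernel q n r) (S n)
  = 2 * (-1) ^ n / (qpoch q q n * qpoch (-1) q n).
Proof.
intros Hq0 Hq.
assert (Hqk : forall k, qpoch q q k <> 0) by (intros; now apply qpoch_neq0).
set (F m := q ^ m * scaled_S q m * (inv_qfact q n (S m) / qpoch q q (n + m))).
assert (T : forall m, (m < n)%nat ->
  bailey_alpha q (S m) * bailey_kernel q n (S m)
  = 2 * (1 + q ^ n) * ((-1) ^ S m * bailey_kernel q n (S m))
    + (F (S m) - F m)).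
{ intros m Hm; unfold F, bailey_kernel.
  rewrite bailey_alpha_S, scaled_S_S, (inv_qfact_S_r q n (S m)) by (auto; lia).
  replace (n + S m)%nat with (S (n + m)) by lia.
  rewrite qpoch_S, (Cpow_add_r q n m).
  replace (q ^ n) with (q ^ S m * q ^ (n - S m))
    by (rewrite <- Cpow_add_r; f_equal; lia).
  rewrite !Cpow_S, Cpow_add_r; field; split; auto.
  replace (q * (q * q ^ m * q ^ (n - S m) * q ^ m))
    with (q * q ^ (S m + (n - S m) + m)) by (rewrite !Cpow_add_r, Cpow_S; ring).
  now apply one_minus_pow_neq0. }
rewrite csum_S_l, (csum_ext _ _ _ T), csum_plus, csum_scal, csum_telescope.
assert (G := alternating_qbinomial_sum q n Hq).
(* The boundary term explains alpha_0 = 2: since 2 - (1 - q^n) = 1 + q^n, the r = 0 term gets the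
   factor 1 + q^n that multiplies the rest of the alternating sum. *)
assert (F0 : F O = (1 - q ^ n) * bailey_kernel q n 0).
{ unfold F, bailey_kernel, scaled_S.
  rewrite S_0, inv_qfact_S_r, Nat.sub_0_r, Nat.add_0_r by (auto; lia).
  simpl; field; auto. }
assert (Fn : F n = 0).
{ unfold F; rewrite inv_qfact_gt by lia; unfold Cdiv; ring. }
rewrite F0, Fn; simpl bailey_alpha.
transitivity ((1 + q ^ n) * (bailey_kernel q n 0
    + 2 * csum (fun m => (-1) ^ S m * bailey_kernel q n (S m)) n)); [ring|].
rewrite G.
assert (M : qpoch (-1) q n * (1 + q ^ n) = 2 * qpoch (- q) q n).
{ rewrite <- qpoch_m1_S, qpoch_S; ring. }
assert (Hm := qpoch_m1_neq0 q n Hq).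
assert (Hm' : qpoch (- q) q n <> 0)
  by (apply qpoch_neq0; auto; now rewrite Cmod_opp).
transitivity ((-1) ^ n * (qpoch (-1) q n * (1 + q ^ n))
  / (qpoch q q n * qpoch (- q) q n * qpoch (-1) q n)); [field; auto|].
rewrite M; field; auto.
Qed.

(** * Bailey's lemma *)

(* Interchanging the sums leaves an inner series of the form
   2phi1(q^(k+1)/a, q^(k+1)/c; q^(2k+1); q, ac/q), summed by q-Gauss. *)
Lemma bailey_lemma (a c q : C) (alpha : nat -> C) (M : R) :
  q <> 0 -> a <> 0 -> c <> 0 -> (Cmod q < 1)%R ->
  (Cmod a < 1)%R -> (Cmod c < 1)%R -> (Cmod (a * c / q) < 1)%R ->
  (forall r, (Cmod (alpha r) <= M)%R) ->
  exists s,
    sums (fun r => qpoch (q / a) q r * qpoch (q / c) q r * (a * c / q) ^ r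
                   / (qpoch a q r * qpoch c q r) * alpha r) s
    /\ sums (fun n => qpoch (q / a) q n * qpoch (q / c) q n * (a * c / q) ^ n
               * csum (fun r => alpha r * bailey_kernel q n r) (S n))
         (qpoch_inf a q * qpoch_inf c q
          / (qpoch_inf q q * qpoch_inf (a * c / q) q) * s).
Proof.
intros Hq0 Ha0 Hc0 Hq Ha Hc Hz HM.
set (z := a * c / q) in *.
assert (N : forall x, (Cmod x < 1)%R ->
              (forall k, qpoch x q k <> 0) /\ qpoch_inf x q <> 0).
{ intros x Hx; split; [|apply qpoch_inf_neq0; auto];
    intros; now apply qpoch_neq0. }
destruct (N q Hq) as [Nq Iq], (N a Ha) as [Na Ia], (N c Hc) as [Nc Ic],
  (N z Hz) as [Nz Iz].
destruct (qpoch_bounded (q / a) q Hq) as [M1 H1].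
destruct (qpoch_bounded (q / c) q Hq) as [M2 H2].
destruct (qpoch_inv_bounded q q Hq Nq) as [M3 H3].
destruct (triangle_sums
  (fun n k => qpoch (q / a) q n * qpoch (q / c) q n
     * (alpha k * bailey_kernel q n k) * z ^ n)
  (fun k => qpoch_inf a q * qpoch_inf c q / (qpoch_inf q q * qpoch_inf z q)
     * (qpoch (q / a) q k * qpoch (q / c) q k * z ^ k
                   / (qpoch a q k * qpoch c q k) * alpha k))
  (M1 * M2 * (M * (M3 * M3))) (Cmod z)) as [s [Hs1 Hs2]].
- split; [apply Cmod_ge_0|auto].
- intros n k Hk; unfold bailey_kernel, Cdiv.
  rewrite inv_qfact_le, !Cmod_mult, Cmod_pow by auto.
  apply Rmult_le_compat_r; [apply pow_le, Cmod_ge_0|].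
  repeat apply Rmult_le_compat; auto using Cmod_ge_0;
    repeat apply Rmult_le_pos; auto using Cmod_ge_0.
- intros k.
  assert (Hqk : q ^ k <> 0) by now apply Cpow_nz.
  assert (EA : q * q ^ (k + k) / (q / a * q ^ k) = a * q ^ k)
    by (rewrite Cpow_add_r; field; auto).
  assert (EB : q * q ^ (k + k) / (q / c * q ^ k) = c * q ^ k)
    by (rewrite Cpow_add_r; field; auto).
  assert (EZ : q * q ^ (k + k) / ((q / a * q ^ k) * (q / c * q ^ k)) = z)
    by (unfold z; rewrite Cpow_add_r; field; auto).
  assert (Nqk : forall m, qpoch (q * q ^ (k + k)) q m <> 0)
    by (intros m; apply qpoch_neq0; auto; now apply Cmod_mul_pow_lt1).
  assert (G := q_gauss (q / a * q ^ k) (q / c * q ^ k) (q * q ^ (k + k)) q Hq).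
  rewrite EA, EB, EZ in G.
  assert (Iqk : qpoch_inf (q * q ^ (k + k)) q <> 0)
    by now apply qpoch_inf_neq0.
  assert (nz : forall x : C, x <> 0 -> q / x * q ^ k <> 0).
  { intros x Hx; apply Cmult_neq_0; [now apply Cdiv_neq0|auto]. }
  specialize (G Hz (Cmod_mul_pow_lt1 _ _ k Ha Hq) (Cmod_mul_pow_lt1 _ _ k Hc Hq)
    (nz a Ha0) (nz c Hc0) (Cmult_neq_0 _ _ Hq0 (Cpow_nz _ _ Hq0)) Nqk).
  (* With n = k + m, the factor (q;q)_(n+k) equals (q;q)_(2k) (q^(2k+1);q)_m, the source of the
     lower parameter q^(2k+1); what depends on k alone is the scalar here. *)
  apply (sums_scal (qpoch (q / a) q k * qpoch (q / c) q k * z ^ k * alpha k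
    / qpoch q q (k + k))) in G.
  match type of G with sums _ ?v => match goal with |- sums _ ?w =>
    replace w with v end end.
  + eapply sums_ext; [|exact G].
    intros m; cbv beta; unfold phi21, bailey_kernel.
    rewrite inv_qfact_le by lia.
    replace (k + m - k)%nat with m by lia.
    replace (k + m + k)%nat with (k + k + m)%nat by lia.
    rewrite (qpoch_add (q / a)), (qpoch_add (q / c)), (qpoch_add q q (k + k)),
      (Cpow_add_r z).
    field; auto.
  + rewrite (qpoch_inf_split a q k Hq), (qpoch_inf_split c q k Hq),
      (qpoch_inf_split q q (k + k) Hq).
    field; auto 10.
(* The exchange yields the sum of P times the alpha-series; since P is nonzero, dividing by it gives
   convergence of the alpha-series itself. *)
- set (P := qpoch_inf a q * qpoch_inf c q / (qpoch_inf q q * qpoch_inf z q)) in *.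
  assert (HP : P <> 0).
  { apply Cdiv_neq0; now apply Cmult_neq_0. }
  exists (/ P * s); split.
  + eapply sums_ext; [|apply (sums_scal (/ P) _ _ Hs2)].
    intros k; cbv beta; field; auto.
  + replace (P * (/ P * s)) with s by (field; auto).
    eapply sums_ext; [|exact Hs1].
    intros n; cbv beta; rewrite <- csum_scal.
    apply csum_ext; intros; ring.
Qed.

(** * Joining Bailey's lemma to Heine's transformation *)

Theorem theorem7p1 (q a c : C) :
  q <> 0 -> (Cmod q < 1)%R ->
  a <> 0 -> c <> 0 ->
  (Cmod a < 1)%R -> (Cmod (c / q) < 1)%R -> (Cmod (a * c / q) < 1)%R ->
  exists s : C,
    is_series (V := C_NormedModule)
      (fun n : nat =>
         (1 + Cpow q (S n)) * (Cpow q (S n * S n) / Cpow q (2 * S n))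
         * (qpoch (q / a) q (S n) * qpoch (q / c) q (S n) * Cpow (a * c) (S n)
            / (qpoch a q (S n) * qpoch c q (S n)))
         * (Cpow q (S n) * S_ q (S n) - S_ q n)) s
    /\
    is_series (V := C_NormedModule)
      (fun n : nat => qpoch (q / c) q n / qpoch (- a) q n * Cpow (- (c / q)) n)
      ((qpoch_inf (- q) q * qpoch_inf a q * qpoch_inf c q * qpoch_inf (- (a * c / q)) q)
       / (qpoch_inf q q * qpoch_inf (- a) q * qpoch_inf (- (c / q)) q
          * qpoch_inf (a * c / q) q)
       * (2 + s)).
Proof.
intros Hq0 Hq Ha0 Hc0 Ha Hcq Hz.
assert (Hc : (Cmod c < 1)%R).
{ replace c with (c / q * q ^ 1) by (simpl; field; auto).
  now apply Cmod_mul_pow_lt1. }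
assert (N : forall x, (Cmod x < 1)%R ->
              (forall k, qpoch x q k <> 0) /\ qpoch_inf x q <> 0).
{ intros x Hx; split; [|apply qpoch_inf_neq0; auto];
    intros; now apply qpoch_neq0. }
destruct (N q Hq) as [Nq Iq], (N a Ha) as [Na Ia], (N c Hc) as [Nc Ic],
  (N _ Hz) as [Nz Iz].
destruct (N (- a)) as [Nma Ima]; [now rewrite Cmod_opp|].
destruct (N (- (c / q))) as [Nmc Imc]; [now rewrite Cmod_opp|].
assert (Nm1 : forall k, qpoch (-1) q k <> 0)
  by (intros; now apply qpoch_m1_neq0).
destruct (bailey_alpha_bounded q Hq0 Hq) as [M HM].
destruct (bailey_lemma a c q _ M Hq0 Ha0 Hc0 Hq Ha Hc Hz HM) as [s [Hs Hb]].
(* Bailey's lemma sums from r = 0, where the term is alpha_0 = 2; the series in the statement starts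
   at 1. *)
exists (s - 2); split.
- apply sums_is_series.
  apply sums_S in Hs.
  replace (s - _) with (s - 2) in Hs by (simpl; field; apply C1_nz).
  eapply sums_ext; [|exact Hs].
  intros n; unfold bailey_alpha.
  replace (q ^ (2 * S n)) with (q ^ S n * q ^ S n)
    by (rewrite <- Cpow_add_r; f_equal; lia).
  assert (Hqn := Cpow_nz q (S n) Hq0).
  replace ((a * c) ^ S n) with ((a * c / q) ^ S n * q ^ S n)
    by (rewrite <- Cpow_mult_l; f_equal; field; auto).
  field; auto.
- apply sums_is_series.
  assert (EBz : q / c * - (c / q) = -1) by (field; auto).
  assert (ECB : - a / (q / c) = - (a * c / q)) by (field; auto).
  (* With A = q the factors (q;q)_n cancel and the first series is the left-hand side. The second
     has parameters ABz/C = q/a and Bz = -1, and argument C/B = -ac/q. *)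
  destruct (heine_second q (q / c) (- a) q (- (c / q))) as [u [t [Hu [Ht E]]]];
    auto.
  + now rewrite Cmod_opp.
  + now rewrite ECB, Cmod_opp.
  + now apply Cdiv_neq0.
  + intros X; apply Ha0; replace a with (- - a) by ring; rewrite X; ring.
  + now rewrite EBz.
  + rewrite EBz, ECB in *.
    replace (q * (q / c) * - (c / q) / - a) with (q / a) in Ht by (field; auto).
    (* The sign (-1)^n of beta_n moves into the argument -ac/q, and its factor 2 is the one in 2
       t. *)
    assert (E2 : 2 * t = qpoch_inf a q * qpoch_inf c q
          / (qpoch_inf q q * qpoch_inf (a * c / q) q) * s).
    { apply (sums_unique _ _ _ (sums_scal 2 _ _ Ht)).
      eapply sums_ext; [|exact Hb].
      intros n; cbv beta; rewrite bailey_pair by auto; unfold phi21.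
      replace (- (a * c / q)) with (-1 * (a * c / q)) by ring.
      rewrite Cpow_mult_l; field; auto. }
    assert (E3 : qpoch_inf (-1) q = 2 * qpoch_inf (- q) q).
    { rewrite (qpoch_inf_split (-1) q 1 Hq); simpl.
      replace (-1 * (q * 1)) with (- q) by ring; ring. }
    rewrite E3 in E.
    match goal with |- sums _ ?w => replace w with u end.
    * eapply sums_ext; [|exact Hu].
      intros n; unfold phi21; field; auto.
    * replace u with (qpoch_inf (- a) q * qpoch_inf (- (c / q)) q * u
        / (qpoch_inf (- a) q * qpoch_inf (- (c / q)) q)) by (field; auto).
      rewrite E.
      transitivity (qpoch_inf (- (a * c / q)) q * qpoch_inf (- q) q * (2 * t)
        / (qpoch_inf (- a) q * qpoch_inf (- (c / q)) q)); [field; auto|].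
      rewrite E2; field; auto 10.
Qed.
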